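(* Let $n\ge 2$ and let $A=[a_{ij}]\in\mathbb{R}^{n\times n}$ be the adjacency matrix of a connected simple undirected weighted graph $\mathcal{G}$ with positive edge weights. Let $\rho$ be the Perron value of $A$, let $u=[u_1,\dots,u_n]^T$ be its Perron vector, and let $W=uu^T=[u_iu_j]_{i,j=1}^n$. Then the Perron impact matrix $R^{(\rho)}$ is given by $$R^{(\rho)}=\frac{2}{\rho}\,A|_{\mathcal{L}}\circ W|_{\mathcal{L}},$$ where $\circ$ denotes the Hadamard (entrywise) product. Moreover, $$\|R^{(\rho)}\|_F\le \frac{\sqrt{2}}{\rho}\,\kappa_{\mathcal{S}}(\rho)\,\|A|_{\mathcal{L}}\|_F ,$$ where $\mathcal{S}\subseteq\mathbb{R}^{n\times n}$ is the cone of all nonnegative symmetric matrices with the same sparsity structure as $A$.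
   Context: The graph $\mathcal{G}$ has nodes $1,\dots,n$, no self-loops and no multiple edges. Its adjacency matrix $A=[a_{ij}]$ is symmetric with zero diagonal; $a_{ij}=a_{ji}>0$ is the weight of the edge between nodes $i$ and $j$ if there is such an edge, and $a_{ij}=0$ otherwise. Since $\mathcal{G}$ is connected, $A$ is irreducible. The Perron value $\rho>0$ is the spectral radius of $A$ (a simple eigenvalue), and the Perron vector $u$ is the unique associated eigenvector of unit Euclidean norm with all entries positive. The Perron impact matrix $R^{(\rho)}\in\mathbb{R}^{n\times n}$ is the strictly lower triangular matrix whose $(i,j)$th entry for $i>j$ is $\frac{2}{\rho}a_{ij}u_iu_j$; this is the first-order estimate of the relative decrease of $\rho$ caused by the removal of the edge between nodes $i$ and $j$. $\mathcal{L}\subseteq\mathbb{R}^{n\times n}$ is the cone of real nonnegative $n\times n$ matrices with the same sparsity structure as the strictly lower triangular part of $A$. For a nonnegative matrix $N$, the projection $N|_{\mathcal{L}}$ keeps the entries of $N$ at positions $(i,j)$ with $i>j$ and $a_{ij}\ne 0$, and sets all other entries to zero. Similarly, for a nonnegative symmetric $N$, the projection $N|_{\mathcal{S}}$ keeps the entries of $N$ at positions $(i,j)$ with $a_{ij}\neq 0$ and sets all other entries to zero. The $\mathcal{S}$-structured condition number of $\rho$ is $\kappa_{\mathcal{S}}(\rho)=\kappa(\rho)\,\|(uu^T)|_{\mathcal{S}}\|_F$, where $\kappa(\rho)=1/|u^Tu|=1$ since $A$ is symmetric. $\|\cdot\|_F$ is the Frobenius norm. *)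

(* Defs.v *)
From mathcomp Require Import all_boot all_order all_algebra.
From mathcomp Require Import classical_sets reals complex.

Set Implicit Arguments.
Unset Strict Implicit.
Unset Printing Implicit Defensive.

Import Order.TTheory GRing.Theory Num.Theory.
Local Open Scope ring_scope.

(* The nodes are 'I_n, i.e. 0, ..., n - 1. The weight function is only
   constrained on the edges; its other values are irrelevant. *)
Record wgraph (R : realType) (n : nat) := WGraph {
  edge : rel 'I_n;
  weight : 'I_n -> 'I_n -> R;
  edge_sym : symmetric edge;
  edge_irr : irreflexive edge;
  weight_sym : forall i j, edge i j -> weight i j = weight j i;
  weight_gt0 : forall i j, edge i j -> 0 < weight i j
}.

Definition connected_graph (R : realType) (n : nat) (G : wgraph R n) : Prop :=
  forall i j, connect (edge G) i j.

Definition adjmx (R : realType) (n : nat) (G : wgraph R n) : 'M[R]_n :=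
  \matrix_(i, j) (if edge G i j then weight G i j else 0).

(* Largest modulus of a complex eigenvalue; the supremum is attained when
   0 < n, by spectral_radius_max below. *)
Definition spectral_radius (R : realType) (n : nat) (A : 'M[R]_n) : R :=
  sup [set x : R | exists z : R[i],
    eigenvalue (map_mx (real_complex R) A) z /\ x = Normc.normc z]%classic.

Definition perron_value (R : realType) (n : nat) (A : 'M[R]_n) : R :=
  spectral_radius A.

Definition frobenius (R : realType) (m n : nat) (N : 'M[R]_(m, n)) : R :=
  Num.sqrt (\sum_i \sum_j N i j ^+ 2).

Definition perron_vector (R : realType) (n : nat) (A : 'M[R]_n)
    (u : 'cV[R]_n) : Prop :=
  [/\ A *m u = perron_value A *: u,
      Num.sqrt (\sum_i u i ord0 ^+ 2) = 1
    & forall i, 0 < u i ord0].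

Definition perron_impact (R : realType) (n : nat) (A : 'M[R]_n)
    (u : 'cV[R]_n) : 'M[R]_n :=
  \matrix_(i, j)
    (if (j < i)%N then 2 / perron_value A * A i j * u i ord0 * u j ord0 else 0).

Definition hadamard (R : realType) (m n : nat) (M N : 'M[R]_(m, n)) :
  'M[R]_(m, n) := map2_mx *%R M N.

(* Membership in a sparsity cone allows additional zeros: the set would
   otherwise not contain 0. *)
Definition coneL (R : realType) (n : nat) (A N : 'M[R]_n) : Prop :=
  (forall i j, 0 <= N i j) /\
  (forall i j : 'I_n, ~~ ((j < i)%N && (A i j != 0)) -> N i j = 0).

Definition coneS (R : realType) (n : nat) (A N : 'M[R]_n) : Prop :=
  [/\ forall i j, 0 <= N i j, N^T = N & forall i j, A i j = 0 -> N i j = 0].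

Definition projL (R : realType) (n : nat) (A N : 'M[R]_n) : 'M[R]_n :=
  \matrix_(i, j) (if (j < i)%N && (A i j != 0) then N i j else 0).

Definition projS (R : realType) (n : nat) (A N : 'M[R]_n) : 'M[R]_n :=
  \matrix_(i, j) (if A i j != 0 then N i j else 0).

(* For a symmetric matrix the unit right eigenvector u is also a left one, so
   the condition number 1 / |y^T x| of the eigenvalue is 1 / |u^T u|. *)
Definition eig_cond (R : realType) (n : nat) (u : 'cV[R]_n) : R :=
  1 / `|(u^T *m u) ord0 ord0|.

Definition eig_condS (R : realType) (n : nat) (A : 'M[R]_n)
    (u : 'cV[R]_n) : R :=
  eig_cond u * frobenius (projS A (u *m u^T)).

Lemma spectral_radius_max (R : realType) (n : nat) (A : 'M[R]_n) :
  (0 < n)%N ->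
  (exists z : R[i], eigenvalue (map_mx (real_complex R) A) z /\
     Normc.normc z = spectral_radius A) /\
  (forall z : R[i], eigenvalue (map_mx (real_complex R) A) z ->
     Normc.normc z <= spectral_radius A).
Proof.
move=> n_gt0; set B := map_mx _ A.
have [r Er] := closed_field_poly_normal (char_poly B).
have Pr z : eigenvalue B z = (z \in r).
  by rewrite eigenvalue_root_char Er (monicP (char_poly_monic B)) scale1r
    root_prod_XsubC.
have r0 : exists z, z \in r.
  case: r Er {Pr} => [|z r] Er; last by exists z; rewrite mem_head.
  have := size_char_poly B; rewrite Er big_nil (monicP (char_poly_monic B)).
  by rewrite scale1r size_poly1 => -[n0]; rewrite -n0 in n_gt0.
have [z zr zmax] : exists2 z, z \in r &
    forall y, y \in r -> Normc.normc y <= Normc.normc z.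
  elim: r r0 {Er Pr} => [[z]//|x r IH _].
  case: (r =P [::]) => [->|/eqP rN0].
    by exists x => [|y]; rewrite ?mem_head// inE => /eqP ->.
  have /IH [z zr zmax] : exists z, z \in r.
    by case: r rN0 {IH} => // z r _; exists z; rewrite mem_head.
  case: (leP (Normc.normc x) (Normc.normc z)) => [xz|/ltW zx].
    exists z => [|y]; first by rewrite inE zr orbT.
    by rewrite inE => /orP[/eqP ->//|/zmax].
  exists x => [|y]; first by rewrite mem_head.
  by rewrite inE => /orP[/eqP ->//|/zmax /le_trans]; apply.
have Ez : Normc.normc z = spectral_radius A.
  apply/le_anti/andP; split.
    apply: ub_le_sup; last by exists z; rewrite Pr.
    by exists (Normc.normc z) => _ [y [+ ->]]; rewrite Pr; apply: zmax.
  apply: ge_sup; first by exists (Normc.normc z), z; rewrite Pr.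
  by move=> _ [y [+ ->]]; rewrite Pr; apply: zmax.
split; first by exists z; rewrite Pr.
by move=> y; rewrite Pr -Ez; apply: zmax.
Qed.

(* projL A and projS A are the Frobenius-nearest-point projections onto the
   two cones. *)
Lemma projLP (R : realType) (n : nat) (A N : 'M[R]_n) :
  (forall i j, 0 <= N i j) ->
  coneL A (projL A N) /\
  (forall M, coneL A M -> frobenius (N - projL A N) <= frobenius (N - M)).
Proof.
move=> N0; split.
  split=> i j; rewrite !mxE; first by case: ifP.
  by move=> /negbTE ->.
move=> M [_ M0]; apply: ler_wsqrtr.
apply: ler_sum => i _; apply: ler_sum => j _; rewrite !mxE.
case: ifP => [_|/negbT /M0 ->//].
by rewrite subrr expr0n sqr_ge0.
Qed.

Lemma projSP (R : realType) (n : nat) (A N : 'M[R]_n) :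
  A^T = A -> (forall i j, 0 <= N i j) -> N^T = N ->
  coneS A (projS A N) /\
  (forall M, coneS A M -> frobenius (N - projS A N) <= frobenius (N - M)).
Proof.
move=> Asym N0 Nsym; split.
  split; first by move=> i j; rewrite !mxE; case: ifP.
    apply/matrixP => i j; rewrite !mxE.
    by rewrite -{1}Asym -{1}Nsym !mxE.
  by move=> i j Aij; rewrite !mxE Aij eqxx.
move=> M [_ _ M0]; apply: ler_wsqrtr.
apply: ler_sum => i _; apply: ler_sum => j _; rewrite !mxE.
case: ifP => [_|/negbFE/eqP /M0 ->//].
by rewrite subrr expr0n sqr_ge0.
Qed.

(* Main.v *)
Require Import Defs.
From mathcomp Require Import all_boot all_order all_algebra.
From mathcomp Require Import reals.

(** The Frobenius norm is submultiplicative for the Hadamard product, and a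
    symmetric matrix supported on the pattern of [A], whose diagonal is zero,
    has squared norm twice that of its strictly lower triangular part; this
    factor turns [2 / rho] into [sqrt 2 / rho]. *)

Import Order.TTheory GRing.Theory Num.Theory.
Local Open Scope ring_scope.

Lemma frobeniusZ (R : realType) (m n : nat) (c : R) (N : 'M[R]_(m, n)) :
  frobenius (c *: N) = `|c| * frobenius N.
Proof.
rewrite /frobenius -sqrtr_sqr -sqrtrM ?sqr_ge0 // mulr_sumr; congr Num.sqrt.
apply: eq_bigr => i _; rewrite mulr_sumr; apply: eq_bigr => j _.
by rewrite mxE exprMn.
Qed.

(** Each [N i j ^+ 2] is one term of the nonnegative double sum under the root of [frobenius N],
    hence at most that sum. *)
Lemma frobenius_hadamard_le (R : realType) (m n : nat) (M N : 'M[R]_(m, n)) :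
  frobenius (hadamard M N) <= frobenius M * frobenius N.
Proof.
have sum_ge0 (P : 'M[R]_(m, n)) : 0 <= \sum_i \sum_j P i j ^+ 2.
  by do 2![apply: sumr_ge0 => ? _]; rewrite sqr_ge0.
rewrite /frobenius -sqrtrM //; apply: ler_wsqrtr.
rewrite mulr_suml; apply: ler_sum => i _.
rewrite mulr_suml; apply: ler_sum => j _.
rewrite mxE exprMn; apply: ler_wpM2l; first exact: sqr_ge0.
(* Isolate the term at [(i, j)]; the rest of row [i] and the other rows are nonnegative. *)
rewrite (bigD1 i) //= (bigD1 j) //= -addrA lerDl addr_ge0 //.
  by apply: sumr_ge0 => ? _; rewrite sqr_ge0.
by do 2![apply: sumr_ge0 => ? _]; rewrite sqr_ge0.
Qed.

Lemma frobenius_projS (R : realType) (n : nat) (A N : 'M[R]_n) :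
  A^T = A -> (forall i, A i i = 0) -> N^T = N ->
  frobenius (projS A N) = Num.sqrt 2 * frobenius (projL A N).
Proof.
move=> Asym A0 Nsym; rewrite /frobenius -sqrtrM ?ler0n //; congr Num.sqrt.
(* Off the diagonal, exactly one of [(i, j)], [(j, i)] lies below it, and by symmetry it carries the
   entry; on the diagonal all terms vanish. *)
have -> : \sum_i \sum_j projS A N i j ^+ 2 =
    \sum_i \sum_j (projL A N i j ^+ 2 + projL A N j i ^+ 2).
  apply: eq_bigr => i _; apply: eq_bigr => j _; rewrite !mxE.
  have -> : A j i = A i j by rewrite -{1}Asym mxE.
  have -> : N j i = N i j by rewrite -{1}Nsym mxE.
  case: (ltngtP i j) => [ij|ji|/val_inj ->] /=.
  - by rewrite expr0n add0r.
  - by rewrite expr0n addr0.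
  - by rewrite A0 eqxx expr0n addr0.
under eq_bigr do rewrite big_split.
(* Swapping the summations turns the transposed half into the first one. *)
by rewrite big_split /= [X in _ + X]exchange_big /= -mulr2n mulr_natl.
Qed.

(** The supremum is attained, so it is the modulus of an eigenvalue, which is a square root. *)
Lemma spectral_radius_ge0 (R : realType) (n : nat) (A : 'M[R]_n) :
  (0 < n)%N -> 0 <= spectral_radius A.
Proof.
move=> /(spectral_radius_max A)[[[a b] [_ <-]] _]; exact: sqrtr_ge0.
Qed.

Lemma adjmx_tr (R : realType) (n : nat) (G : wgraph R n) :
  (adjmx G)^T = adjmx G.
Proof.
apply/matrixP => i j; rewrite !mxE (edge_sym G j i).
by case: ifP => // /(@weight_sym _ _ G).
Qed.

Lemma adjmx_diag (R : realType) (n : nat) (G : wgraph R n) i :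
  adjmx G i i = 0.
Proof. by rewrite mxE edge_irr. Qed.

Lemma perron_impactE (R : realType) (n : nat) (A : 'M[R]_n) (u : 'cV[R]_n) :
  perron_impact A u =
  (2 / perron_value A) *: hadamard (projL A A) (projL A (u *m u^T)).
Proof.
apply/matrixP => i j; rewrite !mxE big_ord1 !mxE.
case: ifP => _ /=; last by rewrite !mulr0.
(* Where [A i j = 0], the mask in [projL] is harmless: both sides are zero. *)
by case: eqP => [->|_] /=; rewrite ?mulr0 ?mul0r // !mulrA.
Qed.

Lemma eig_cond_unit (R : realType) (n : nat) (u : 'cV[R]_n) :
  Num.sqrt (\sum_i u i ord0 ^+ 2) = 1 -> eig_cond u = 1.
Proof.
move=> u1; rewrite /eig_cond.
have -> : (u^T *m u) ord0 ord0 = 1.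
  rewrite mxE -(expr1n _ 2) -u1 sqr_sqrtr; last first.
    by apply: sumr_ge0 => i _; rewrite sqr_ge0.
  by apply: eq_bigr => i _; rewrite mxE.
by rewrite normr1 divr1.
Qed.

Theorem proposition3 (R : realType) (n : nat) (hn : (2 <= n)%N)
    (G : wgraph R n) (hG : connected_graph G) (u : 'cV[R]_n)
    (hu : perron_vector (adjmx G) u) :
  let A := adjmx G in
  let rho := perron_value A in
  let W := u *m u^T in
  perron_impact A u = (2 / rho) *: hadamard (projL A A) (projL A W) /\
  frobenius (perron_impact A u) <=
    Num.sqrt 2 / rho * eig_condS A u * frobenius (projL A A).
Proof.
move=> A rho W; split; first exact: perron_impactE.
have [_ /eig_cond_unit u1 _] := hu.
have rho_ge0 : 0 <= rho by apply: spectral_radius_ge0; exact: ltnW.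
have Wsym : W^T = W by rewrite trmx_mul trmxK.
rewrite /eig_condS u1 mul1r.
rewrite (frobenius_projS _ _ _ _ (adjmx_tr _ _ G) (adjmx_diag _ _ G) Wsym).
rewrite perron_impactE frobeniusZ ger0_norm ?divr_ge0 ?ler0n //.
(* The [Num.sqrt 2] of the bound and the one from [frobenius_projS] multiply to the 2 of
   [2 / rho]. *)
have -> : Num.sqrt 2 / rho * (Num.sqrt 2 * frobenius (projL A W)) *
    frobenius (projL A A) =
    2 / rho * (frobenius (projL A A) * frobenius (projL A W)).
  rewrite -{3}(sqr_sqrtr (ler0n R 2)) expr2 -!mulrA; congr (_ * _).
  by rewrite mulrCA [X in _ * (_ * X)]mulrC.
by apply: ler_wpM2l; rewrite ?divr_ge0 ?ler0n ?frobenius_hadamard_le.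
Qed.
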